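(* (Soundness.) Let $n\geq 1$ and let $\mathbf{G}$ and $\mathbf{H}$ be words over $\mathcal{G}_n$. If $\mathbf{G}\approx\mathbf{H}$ (i.e. one can be rewritten into the other using the relations listed in the context), then $\mathbf{G}\sim\mathbf{H}$ (i.e. $\mathbf{G}$ and $\mathbf{H}$ denote the same matrix in $\mathrm{O}_n(\mathbb{Z}[1/2])$).
   Context: $\mathbb{Z}[1/2]=\{u/2^k\mid u\in\mathbb{Z},k\in\mathbb{N}\}$; $\mathrm{O}_n(\mathbb{Z}[1/2])$ is the group of $n\times n$ orthogonal matrices with entries in $\mathbb{Z}[1/2]$. Let $X=\begin{bmatrix}0&1\\1&0\end{bmatrix}$ and $K=\frac12\begin{bmatrix}1&1&1&1\\1&-1&1&-1\\1&1&-1&-1\\1&-1&-1&1\end{bmatrix}$. For an $m\times m$ matrix $M$ and distinct $a_1,\dots,a_m\in\{1,\dots,n\}$, $M_{[a_1,\dots,a_m]}$ is the $n\times n$ matrix whose $(a_{i'},a_{j'})$ entry is $M_{i',j'}$ and whose other entries are those of the identity. The set of generators is $\mathcal{G}_n=\{(-1)_{[a]},X_{[a,b]},K_{[a,b,c,d]}\mid 1\leq a<b<c<d\leq n\}$ (each type of generator is included whenever its own indices are increasing and in $\{1,\dots,n\}$). A word over $\mathcal{G}_n$ is a finite sequence of generators, $\epsilon$ is the empty word; a word $G_1\ldots G_m$ is interpreted as the matrix product $G_1\cdots G_m$. $\mathbf{V}\sim\mathbf{W}$ means that $\mathbf{V}$ and $\mathbf{W}$ have the same interpretation. $\approx$ is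 the smallest congruence (equivalence relation compatible with concatenation) on words over $\mathcal{G}_n$ containing the following relations, where in each relation the indices named by distinct letters are distinct elements of $\{1,\dots,n\}$ and the relation is well-formed (all generators occurring in it have increasing indices, i.e. belong to $\mathcal{G}_n$): (1) $X_{[a,b]}^2\approx\epsilon$; $(-1)_{[a]}^2\approx\epsilon$; $K_{[a,b,c,d]}^2\approx\epsilon$. (2) $X_{[a,b]}X_{[c,d]}\approx X_{[c,d]}X_{[a,b]}$; $X_{[a,b]}(-1)_{[c]}\approx(-1)_{[c]}X_{[a,b]}$; $X_{[a,b]}K_{[c,d,e,f]}\approx K_{[c,d,e,f]}X_{[a,b]}$; $(-1)_{[a]}(-1)_{[b]}\approx(-1)_{[b]}(-1)_{[a]}$; $(-1)_{[a]}K_{[b,c,d,e]}\approx K_{[b,c,d,e]}(-1)_{[a]}$; $K_{[a,b,c,d]}K_{[e,f,g,h]}\approx K_{[e,f,g,h]}K_{[a,b,c,d]}$. (3) $X_{[a,a']}X_{[a,b]}\approx X_{[a',b]}X_{[a,a']}$; $X_{[b,b']}X_{[a,b]}\approx X_{[a,b']}X_{[b,b']}$; $X_{[a,b]}(-1)_{[b]}\approx(-1)_{[a]}X_{[a,b]}$; $X_{[a,a']}K_{[a,b,c,d]}\approx K_{[a',b,c,d]}X_{[a,a']}$; $X_{[b,b']}K_{[a,b,c,d]}\approx K_{[a,b',c,d]}X_{[b,b']}$; $X_{[c,c']}K_{[a,b,c,d]}\approx K_{[a,b,c',d]}X_{[c,c']}$; $X_{[d,d']}K_{[a,b,c,d]}\approx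 K_{[a,b,c,d']}X_{[d,d']}$. (4) $X_{[a,b]}K_{[a,b,c,d]}\approx K_{[a,b,c,d]}X_{[b,d]}(-1)_{[b]}(-1)_{[d]}$; $X_{[b,c]}K_{[a,b,c,d]}\approx(-1)_{[a]}K_{[a,b,c,d]}(-1)_{[a]}K_{[a,b,c,d]}(-1)_{[a]}$; $X_{[c,d]}K_{[a,b,c,d]}\approx K_{[a,b,c,d]}X_{[b,d]}$. (5) $K_{[a,b,c,d]}K_{[b,d,e,f]}\approx K_{[c,d,e,f]}K_{[a,b,c,e]}$ (for $a<b<c<d<e<f$). (6) $(-1)_{[a]}(-1)_{[e]}X_{[a,e]}\,\mathbf{M}\,X_{[a,e]}(-1)_{[a]}(-1)_{[e]}\approx\mathbf{M}$, where $\mathbf{M}$ is the word $K_{[e,f,g,h]}K_{[a,b,c,d]}X_{[d,e]}K_{[a,b,c,d]}K_{[e,f,g,h]}$ (for $a<b<\dots<h$). *)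

(* Defs.v *)
From HB Require Import structures.
From mathcomp Require Import all_boot all_order all_algebra.
From mathcomp Require Import boolp ring.

Set Implicit Arguments.
Unset Strict Implicit.
Unset Printing Implicit Defensive.

Import Order.TTheory GRing.Theory Num.Theory.
Local Open Scope ring_scope.

(** * The ring Z[1/2] *)

Definition dyadic_pred : {pred rat} :=
  fun x => `[< exists (u : int) (k : nat), x = u%:~R / 2 ^+ k >].

Lemma dyadicP (x : rat) :
  reflect (exists (u : int) (k : nat), x = u%:~R / 2 ^+ k) (x \in dyadic_pred).
Proof. exact: asboolP. Qed.

Lemma dyadic_subring_closed : subring_closed dyadic_pred.
Proof.
have nz k : 2 ^+ k != 0 :> rat by rewrite expf_neq0.
split=> [|x y|x y].
- by apply/dyadicP; exists 1, 0; rewrite expr0 divr1.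
- case/dyadicP=> u [k ->] /dyadicP[v [l ->]]; apply/dyadicP.
  exists (u * 2 ^+ l - v * 2 ^+ k), (k + l)%N.
  rewrite rmorphB !rmorphM !rmorphXn /= exprD.
  by field; rewrite !nz.
- case/dyadicP=> u [k ->] /dyadicP[v [l ->]]; apply/dyadicP.
  by exists (u * v), (k + l)%N; rewrite rmorphM /= exprD mulf_div.
Qed.

HB.instance Definition _ :=
  GRing.isSubringClosed.Build rat dyadic_pred dyadic_subring_closed.

Record dyadic : Type :=
  Dyadic { dyadic_val :> rat; dyadic_valP : dyadic_val \in dyadic_pred }.

HB.instance Definition _ := [isSub for dyadic_val].
HB.instance Definition _ := [Choice of dyadic by <:].
HB.instance Definition _ := [SubChoice_isSubComNzRing of dyadic by <:].

Lemma half_in_dyadic : 2^-1 \in dyadic_pred.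
Proof. by apply/dyadicP; exists 1, 1%N; rewrite mul1r. Qed.

Definition half : dyadic := Dyadic half_in_dyadic.

Lemma half2 : half *+ 2 = 1.
Proof. exact/val_inj. Qed.

(** * The orthogonal group of a commutative ring *)

Section Orthogonal.
Variables (R : comNzRingType) (n : nat).

Definition orthogonal_mx (A : 'M[R]_n) : bool := A *m A^T == 1%:M.

Record orthogonal : Type :=
  Orthogonal { orthogonal_val :> 'M[R]_n; _ : orthogonal_mx orthogonal_val }.

HB.instance Definition _ := [isSub for orthogonal_val].
HB.instance Definition _ := [Choice of orthogonal by <:].

Implicit Types A B C : orthogonal.

Lemma orthogonalP A : (A : 'M_n) *m (A : 'M_n)^T = 1%:M.
Proof. by case: A => A /= /eqP. Qed.

Lemma orthogonal_one_subproof : orthogonal_mx 1%:M.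
Proof. by rewrite /orthogonal_mx trmx1 mul1mx. Qed.

Lemma orthogonal_mul_subproof A B :
  orthogonal_mx ((A : 'M_n) *m (B : 'M_n)).
Proof.
rewrite /orthogonal_mx trmx_mul mulmxA -[X in X *m _]mulmxA orthogonalP.
by rewrite mulmx1 orthogonalP.
Qed.

Lemma orthogonal_inv_subproof A : orthogonal_mx (A : 'M_n)^T.
Proof. by rewrite /orthogonal_mx trmxK (mulmx1C (orthogonalP A)). Qed.

Definition orthogonal_one := Orthogonal orthogonal_one_subproof.
Definition orthogonal_mul A B := Orthogonal (orthogonal_mul_subproof A B).
Definition orthogonal_inv A := Orthogonal (orthogonal_inv_subproof A).

Lemma orthogonal_mulA : associative orthogonal_mul.
Proof. by move=> A B C; apply/val_inj; rewrite /= mulmxA. Qed.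

Lemma orthogonal_mul1g : left_id orthogonal_one orthogonal_mul.
Proof. by move=> A; apply/val_inj; rewrite /= mul1mx. Qed.

Lemma orthogonal_mulg1 : right_id orthogonal_one orthogonal_mul.
Proof. by move=> A; apply/val_inj; rewrite /= mulmx1. Qed.

Lemma orthogonal_mulVg :
  left_inverse orthogonal_one orthogonal_inv orthogonal_mul.
Proof. by move=> A; apply/val_inj; rewrite /= (mulmx1C (orthogonalP A)). Qed.

Lemma orthogonal_mulgV :
  right_inverse orthogonal_one orthogonal_inv orthogonal_mul.
Proof. by move=> A; apply/val_inj; rewrite /= orthogonalP. Qed.

HB.instance Definition _ := isGroup.Build orthogonal
  orthogonal_mulA orthogonal_mul1g orthogonal_mulg1
  orthogonal_mulVg orthogonal_mulgV.

End Orthogonal.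

(** * Matrices acting on selected indices *)

Section Embed.
Variables (R : comNzRingType) (m n : nat).

(* The matrix M_[a_1, ..., a_m]; meaningful when the a_i are distinct. *)
Definition embed (M : 'M[R]_m) (a : m.-tuple 'I_n) : 'M[R]_n :=
  \matrix_(i, j)
    if [pick p : 'I_m * 'I_m | (tnth a p.1 == i) && (tnth a p.2 == j)] is Some p
    then M p.1 p.2 else (i == j)%:R.

Variables (M : 'M[R]_m) (a : m.-tuple 'I_n).
Hypothesis a_uniq : uniq a.

Lemma embed_in i' j' : embed M a (tnth a i') (tnth a j') = M i' j'.
Proof.
have a_inj : injective (tnth a) by apply/tuple_uniqP.
rewrite mxE; case: pickP => [p /andP[/eqP/a_inj-> /eqP/a_inj->] //|].
by move/(_ (i', j')); rewrite /= !eqxx.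
Qed.

Lemma embed_outl i j : i \notin a -> embed M a i j = (i == j)%:R.
Proof.
move=> ai; rewrite mxE; case: pickP => // p /andP[/eqP pi _].
by rewrite -pi mem_tnth in ai.
Qed.

Lemma embed_outr i j : j \notin a -> embed M a i j = (i == j)%:R.
Proof.
move=> aj; rewrite mxE; case: pickP => // p /andP[_ /eqP pj].
by rewrite -pj mem_tnth in aj.
Qed.

Lemma embed_orthogonal : orthogonal_mx M -> orthogonal_mx (embed M a).
Proof.
have a_inj : injective (tnth a) by apply/tuple_uniqP.
move=> /eqP MM; apply/eqP/matrixP=> i j; rewrite mxE [RHS]mxE.
under eq_bigr => k _ do rewrite [X in _ * X]mxE.
have out (x y : 'I_n) : x \notin a ->
    \sum_k embed M a x k * embed M a y k = (x == y)%:R.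
  move=> ax; rewrite (bigD1 x) //= big1 => [|k kx]; last first.
    by rewrite embed_outl // eq_sym (negPf kx) mul0r.
  by rewrite embed_outl // eqxx mul1r addr0 embed_outr // eq_sym.
have [/tnthP[i' ->]|/out//] := boolP (i \in a).
have [/tnthP[j' ->]|aj] := boolP (j \in a); last first.
  by under eq_bigr do rewrite mulrC; rewrite out // eq_sym.
rewrite (inj_eq a_inj).
transitivity ((M *m M^T) i' j'); last by rewrite MM mxE.
rewrite (bigID (mem a)) /= [X in _ + X]big1 => [|k ak]; last first.
  rewrite embed_outr //; case: eqP => [ik|_]; last by rewrite mul0r.
  by rewrite -ik mem_tnth in ak.
rewrite addr0 -big_uniq // big_tuple mxE; apply: eq_bigr => k _.
by rewrite !embed_in mxE.
Qed.

End Embed.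

(** * The generators *)

Definition X_mx : 'M[dyadic]_2 := \matrix_(i, j) (i != j)%:R.

Definition K_mx : 'M[dyadic]_4 :=
  half *: \matrix_(i, j) nth 0 (nth [::]
    [:: [:: 1;  1;  1;  1];
        [:: 1; -1;  1; -1];
        [:: 1;  1; -1; -1];
        [:: 1; -1; -1;  1]] i) j.

(* [letter] is raw syntax: its indices need not be increasing. *)
Inductive letter (n : nat) : Type :=
| Neg of 'I_n
| Swap of 'I_n & 'I_n
| Had of 'I_n & 'I_n & 'I_n & 'I_n.

Declare Scope letter_scope.
Delimit Scope letter_scope with L.
Notation "N_[ a ]" := (Neg a) (format "N_[ a ]") : letter_scope.
Notation "X_[ a , b ]" := (Swap a b) (format "X_[ a , b ]") : letter_scope.
Notation "K_[ a , b , c , d ]" := (Had a b c d)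
  (format "K_[ a , b , c , d ]") : letter_scope.

Definition letter_arity n (l : letter n) : nat :=
  match l with Neg _ => 1 | Swap _ _ => 2 | Had _ _ _ _ => 4 end.

Definition letter_idx n (l : letter n) : (letter_arity l).-tuple 'I_n :=
  match l with
  | Neg a => [tuple a]
  | Swap a b => [tuple a; b]
  | Had a b c d => [tuple a; b; c; d]
  end.

Definition letter_block n (l : letter n) : 'M[dyadic]_(letter_arity l) :=
  match l with
  | Neg _ => (-1)%:M
  | Swap _ _ => X_mx
  | Had _ _ _ _ => K_mx
  end.

Definition letter_mx n (l : letter n) : 'M[dyadic]_n :=
  embed (letter_block l) (letter_idx l).

Definition increasing n (s : seq 'I_n) : bool :=
  sorted (fun i j : 'I_n => (i < j)%N) s.

Lemma increasing_uniq n (s : seq 'I_n) : increasing s -> uniq s.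
Proof.
by apply: sorted_uniq => [j i k|i]; [exact: ltn_trans | exact: ltnn].
Qed.

Record generator (n : nat) : Type :=
  Generator { gen_letter : letter n; gen_incr : increasing (letter_idx gen_letter) }.

Lemma letter_block_orthogonal n (l : letter n) : orthogonal_mx (letter_block l).
Proof.
have h4 : half * half *+ 4 = 1.
  by rewrite -[4%N]/(2 * 2)%N mulrnA -mulrnAr half2 mulr1 half2.
rewrite /orthogonal_mx; apply/eqP; case: l => [a|a b|a b c d] /=.
- by rewrite tr_scalar_mx -scalar_mxM mulrNN mulr1.
- apply/matrixP => i j; rewrite !mxE !big_ord_recl big_ord0 !mxE.
  by case: i j => [[|[|//]] ?] [[|[|//]] ?] /=; ring.
- rewrite /K_mx linearZ /= -scalemxAl -scalemxAr scalerA.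
  apply/matrixP => i j; rewrite !mxE !big_ord_recl big_ord0 !mxE.
  case: i j => [[|[|[|[|//]]]] ?] [[|[|[|[|//]]]] ?] /=;
    rewrite -?[1%R *+ _]/(1%R : dyadic) -?[RHS]h4; ring.
Qed.

Lemma gen_orthogonal n (g : generator n) : orthogonal_mx (letter_mx (gen_letter g)).
Proof.
by apply: embed_orthogonal (letter_block_orthogonal _); exact/increasing_uniq/gen_incr.
Qed.

Definition gen_mx n (g : generator n) : orthogonal dyadic n := Orthogonal (gen_orthogonal g).

(** * Words *)

Definition word (n : nat) : Type := seq (generator n).

Definition interp n (W : word n) : orthogonal dyadic n := (\prod_(g <- W) gen_mx g)%g.

Definition sim n (V W : word n) : Prop := interp V = interp W.

Local Open Scope letter_scope.

(* The defining relations, between raw sequences of letters. Well-formedness is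
   not required here: it is imposed in [approx], where both sides are words. *)
Inductive relation (n : nat) : seq (letter n) -> seq (letter n) -> Prop :=
| rel_1X a b : uniq [:: a; b] ->
    relation [:: X_[a,b]; X_[a,b]] [::]
| rel_1N a :
    relation [:: N_[a]; N_[a]] [::]
| rel_1K a b c d : uniq [:: a; b; c; d] ->
    relation [:: K_[a,b,c,d]; K_[a,b,c,d]] [::]

| rel_2XX a b c d : uniq [:: a; b; c; d] ->
    relation [:: X_[a,b]; X_[c,d]] [:: X_[c,d]; X_[a,b]]
| rel_2XN a b c : uniq [:: a; b; c] ->
    relation [:: X_[a,b]; N_[c]] [:: N_[c]; X_[a,b]]
| rel_2XK a b c d e f : uniq [:: a; b; c; d; e; f] ->
    relation [:: X_[a,b]; K_[c,d,e,f]] [:: K_[c,d,e,f]; X_[a,b]]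
| rel_2NN a b : uniq [:: a; b] ->
    relation [:: N_[a]; N_[b]] [:: N_[b]; N_[a]]
| rel_2NK a b c d e : uniq [:: a; b; c; d; e] ->
    relation [:: N_[a]; K_[b,c,d,e]] [:: K_[b,c,d,e]; N_[a]]
| rel_2KK a b c d e f g h : uniq [:: a; b; c; d; e; f; g; h] ->
    relation [:: K_[a,b,c,d]; K_[e,f,g,h]] [:: K_[e,f,g,h]; K_[a,b,c,d]]

| rel_3Xl a a' b : uniq [:: a; a'; b] ->
    relation [:: X_[a,a']; X_[a,b]] [:: X_[a',b]; X_[a,a']]
| rel_3Xr a b b' : uniq [:: a; b; b'] ->
    relation [:: X_[b,b']; X_[a,b]] [:: X_[a,b']; X_[b,b']]
| rel_3N a b : uniq [:: a; b] ->
    relation [:: X_[a,b]; N_[b]] [:: N_[a]; X_[a,b]]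
| rel_3Ka a a' b c d : uniq [:: a; a'; b; c; d] ->
    relation [:: X_[a,a']; K_[a,b,c,d]] [:: K_[a',b,c,d]; X_[a,a']]
| rel_3Kb a b b' c d : uniq [:: a; b; b'; c; d] ->
    relation [:: X_[b,b']; K_[a,b,c,d]] [:: K_[a,b',c,d]; X_[b,b']]
| rel_3Kc a b c c' d : uniq [:: a; b; c; c'; d] ->
    relation [:: X_[c,c']; K_[a,b,c,d]] [:: K_[a,b,c',d]; X_[c,c']]
| rel_3Kd a b c d d' : uniq [:: a; b; c; d; d'] ->
    relation [:: X_[d,d']; K_[a,b,c,d]] [:: K_[a,b,c,d']; X_[d,d']]

| rel_4ab a b c d : uniq [:: a; b; c; d] ->
    relation [:: X_[a,b]; K_[a,b,c,d]]
             [:: K_[a,b,c,d]; X_[b,d]; N_[b]; N_[d]]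
| rel_4bc a b c d : uniq [:: a; b; c; d] ->
    relation [:: X_[b,c]; K_[a,b,c,d]]
             [:: N_[a]; K_[a,b,c,d]; N_[a]; K_[a,b,c,d]; N_[a]]
| rel_4cd a b c d : uniq [:: a; b; c; d] ->
    relation [:: X_[c,d]; K_[a,b,c,d]] [:: K_[a,b,c,d]; X_[b,d]]

| rel_5 a b c d e f : increasing [:: a; b; c; d; e; f] ->
    relation [:: K_[a,b,c,d]; K_[b,d,e,f]] [:: K_[c,d,e,f]; K_[a,b,c,e]]

| rel_6 a b c d e f g h : increasing [:: a; b; c; d; e; f; g; h] ->
    let M := [:: K_[e,f,g,h]; K_[a,b,c,d]; X_[d,e]; K_[a,b,c,d]; K_[e,f,g,h]] in
    relation ([:: N_[a]; N_[e]; X_[a,e]] ++ M ++ [:: X_[a,e]; N_[a]; N_[e]]) M.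

Inductive approx (n : nat) : word n -> word n -> Prop :=
| approx_rel V W :
    relation (map (@gen_letter n) V) (map (@gen_letter n) W) -> approx V W
| approx_refl V : approx V V
| approx_sym V W : approx V W -> approx W V
| approx_trans U V W : approx U V -> approx V W -> approx U W
| approx_cat V V' W W' :
    approx V V' -> approx W W' -> approx (V ++ W) (V' ++ W').

(* Main.v *)
(* A word acts on column vectors letter by letter, and both sides of every
   relation act in the same way. The latter is checked one coordinate i at a
   time: whether i is one of the named indices (and which one) decides all the
   index tests, leaving a linear identity over the rationals in the entries. *)

Require Import Defs.
From mathcomp Require Import all_boot.
From mathcomp Require Import all_algebra ring lra.

Set Implicit Arguments.
Unset Strict Implicit.
Unset Printing Implicit Defensive.

Import GRing.Theory.
Local Open Scope ring_scope.

Section EmbedMul.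
Variables (R : comNzRingType) (k n p : nat).
Variables (M : 'M[R]_k) (a : k.-tuple 'I_n) (A : 'M[R]_(n, p)).
Hypothesis a_uniq : uniq a.

Lemma mul_embed_out i j : i \notin a -> (embed M a *m A) i j = A i j.
Proof.
move=> ai; rewrite mxE (bigD1 i) //= embed_outl // eqxx mul1r big1 ?addr0 //.
by move=> l li; rewrite embed_outl // eq_sym (negPf li) mul0r.
Qed.

Lemma mul_embed_in i' j :
  (embed M a *m A) (tnth a i') j = \sum_l M i' l * A (tnth a l) j.
Proof.
(* Columns outside [a] contribute nothing: there the matrix agrees with the identity, and the row
   index lies in [a]. *)
rewrite mxE (bigID (mem a)) /= [X in _ + X]big1 => [|l al]; last first.
  rewrite embed_outr //; case: eqP => [il|_]; last by rewrite mul0r.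
  by rewrite -il mem_tnth in al.
by rewrite addr0 -big_uniq // big_tuple; apply: eq_bigr => l _; rewrite embed_in.
Qed.

End EmbedMul.

(* The action of the matrix of a letter on column vectors, in coordinates; it is
   the correct one only when the indices of the letter are distinct. *)
Definition letter_act n (l : letter n) (v : 'I_n -> dyadic) (i : 'I_n) : dyadic :=
  match l with
  | Neg a => if i == a then - v i else v i
  | Swap a b => if i == a then v b else if i == b then v a else v i
  | Had a b c d =>
      if i == a then Defs.half * (v a + v b + v c + v d)
      else if i == b then Defs.half * (v a - v b + v c - v d)
      else if i == c then Defs.half * (v a + v b - v c - v d)
      else if i == d then Defs.half * (v a - v b - v c + v d)
      else v i
  end.

Definition word_act n (s : seq (letter n)) (v : 'I_n -> dyadic) : 'I_n -> dyadic :=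
  foldr (@letter_act n) v s.

Lemma eq_letter_act n (l : letter n) v w :
  v =1 w -> letter_act l v =1 letter_act l w.
Proof. by move=> vw i; case: l => * /=; rewrite !vw. Qed.

Lemma mul_letter_mx n p (l : letter n) (A : 'M[dyadic]_(n, p)) i j :
  uniq (letter_idx l) -> (letter_mx l *m A) i j = letter_act l (A^~ j) i.
Proof.
move=> l_uniq.
have in_ := mul_embed_in (letter_block l) A l_uniq.
have out := mul_embed_out (letter_block l) A.
case: l l_uniq in_ out => [a|a b|a b c d] /= l_uniq in_ out.
- case: eqP => [->|/eqP ia]; last by rewrite out ?inE.
  by rewrite (in_ ord0) big_ord1 mxE eqxx mulN1r.
- case: eqP => [->|/eqP ia].
    rewrite (in_ ord0) !big_ord_recl big_ord0 !mxE /=.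
    by rewrite mul0r mul1r add0r addr0.
  case: eqP => [->|/eqP ib]; last by rewrite out // !inE negb_or ia.
  rewrite (in_ ord_max) !big_ord_recl big_ord0 !mxE /=.
  by rewrite mul0r mul1r add0r addr0.
- set t := [tuple a; b; c; d] in in_ out *.
  (* [half] is pulled out of the sum, as in [letter_act]; the signs stay a literal table, computed
     once the row [k] is fixed. *)
  have inK (k : 'I_4) : (letter_mx (Had a b c d) *m A) (tnth t k) j =
      Defs.half * \sum_(m < 4) nth 0 (nth [::] [:: [:: 1;  1;  1;  1];
          [:: 1; -1;  1; -1]; [:: 1;  1; -1; -1]; [:: 1; -1; -1;  1]] k) m
        * A (tnth t m) j.
    rewrite in_ mulr_sumr.
    by apply: eq_bigr => m _; rewrite [K_mx _ _]mxE mxE mulrA.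
  case: eqP => [->|/eqP ia].
    by rewrite (inK (@Ordinal 4 0 isT)) !big_ord_recl big_ord0 /= /tnth /=; ring.
  case: eqP => [->|/eqP ib].
    by rewrite (inK (@Ordinal 4 1 isT)) !big_ord_recl big_ord0 /= /tnth /=; ring.
  case: eqP => [->|/eqP ic].
    by rewrite (inK (@Ordinal 4 2 isT)) !big_ord_recl big_ord0 /= /tnth /=; ring.
  case: eqP => [->|/eqP id].
    by rewrite (inK (@Ordinal 4 3 isT)) !big_ord_recl big_ord0 /= /tnth /=; ring.
  by rewrite out // !inE !negb_or ia ib ic.
Qed.

(** Column [j] of a matrix is its value on the [j]-th basis vector, so comparing interpretations
    reduces to comparing actions. *)
Lemma interpE n (W : word n) i j :
  (interp W : 'M_n) i j = word_act (map (@gen_letter n) W) ((1%:M : 'M_n)^~ j) i.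
Proof.
rewrite /interp; elim: W i => [|g W IH] i; rewrite ?big_nil // big_cons /=.
rewrite mul_letter_mx; last exact/increasing_uniq/gen_incr.
exact: eq_letter_act.
Qed.

Lemma interp_cat n (V W : word n) : interp (V ++ W) = (interp V * interp W)%g.
Proof. exact: big_cat. Qed.

(** Each disequality is kept in both orientations, as an index test may use either. *)
Ltac uniq_neqs H :=
  move: H; rewrite /= ?inE ?negb_or ?andbT; intro H;
  repeat match goal with
  | H' : is_true (_ && _) |- _ => case/andP: H'; do 2 intro
  end;
  repeat match goal with
  | E : is_true (?x != ?y) |- _ =>
      move/negPf in E; pose proof E; rewrite eq_sym in E
  end.

Ltac simpl_if :=
  repeat match goal with
  | |- context [?x == ?y] =>
    first [ constr_eq x y; rewrite (eqxx x)
          | match goal with E : (x == y) = false |- _ => rewrite E end ]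
  end.

Lemma letter_act_Neg n (a : 'I_n) v i :
  letter_act (Neg a) v i = if i == a then - v i else v i.
Proof. by []. Qed.

Lemma letter_act_Swap n (a b : 'I_n) v i :
  letter_act (Swap a b) v i =
  if i == a then v b else if i == b then v a else v i.
Proof. by []. Qed.

Lemma letter_act_Had n (a b c d : 'I_n) v i :
  letter_act (Had a b c d) v i =
  if i == a then Defs.half * (v a + v b + v c + v d)
  else if i == b then Defs.half * (v a - v b + v c - v d)
  else if i == c then Defs.half * (v a + v b - v c - v d)
  else if i == d then Defs.half * (v a - v b - v c + v d)
  else v i.
Proof. by []. Qed.

(* Unfolding the letters one at a time, outermost first, and deciding the index
   tests at once keeps the number of conditional branches from exploding. *)
Ltac eval_word_act :=
  repeat (match goal with
  | |- context [letter_act ?l ?v ?i] =>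
    lazymatch l with
    | Neg ?a => rewrite -> (letter_act_Neg a v i)
    | Swap ?a ?b => rewrite -> (letter_act_Swap a b v i)
    | Had ?a ?b ?c ?d => rewrite -> (letter_act_Had a b c d v i)
    end
  end; simpl_if).

(** The named indices are read off the recorded disequalities, whose two orientations make each
    index occur on the left. *)
Ltac split_word_act i :=
  repeat match goal with
  | _ : context [?x == ?y] |- _ =>
    lazymatch goal with
    | _ : (i == x) = false |- _ => fail
    | _ => case: (eqVneq i x) => [->|/negPf ?]; [eval_word_act|]
    end
  end; eval_word_act.

Local Opaque letter_act.

Lemma relation_act n (s t : seq (letter n)) v :
  relation s t -> word_act s v =1 word_act t v.
Proof.
(* With [letter_act] opaque, this stops at nested letter actions, before any index test appears. *)
case=> * i; rewrite /word_act /=.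
(* [rel_1N] is the only relation without a distinctness hypothesis. *)
2: by rewrite !letter_act_Neg; case: eqP => _; rewrite ?opprK.
all: match goal with
     | H : is_true (uniq _) |- _ => uniq_neqs H
     | H : is_true (increasing _) |- _ => move/increasing_uniq in H; uniq_neqs H
     end.
(* [ring] sees [half] as an indeterminate; goals that depend on its value are moved to the
   rationals, where it is 1/2. *)
all: split_word_act i; first [ring | by apply: val_inj => /=; lra].
Qed.

Theorem theorem4p3 (n : nat) (hn : (1 <= n)%N) (G H : word n) :
  approx G H -> sim G H.
Proof.
rewrite /sim; elim=> {G H} [V W VW||V W _ ->|U V W _ -> _ ->|V V' W W' _ VV _ WW] //.
- by apply/val_inj/matrixP=> i j; rewrite /= !interpE (relation_act _ VW).
- by rewrite !interp_cat VV WW.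
Qed.
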